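(* Let $g\in C(\partial\Omega)$. Assume that $f\in C(\Omega)\cap L^\infty(\Omega)$ and $\{f_k\}_{k=1}^\infty\subseteq C(\Omega)\cap L^\infty(\Omega)$ are such that $\sup_{k\ge1}\|f_k\|_{L^\infty(\Omega)}<\infty$ and $f_k\to f$ locally uniformly in $\Omega$ as $k\to\infty$. Suppose that for each $k$ the function $u_k\in C(\bar\Omega)$ is a viscosity solution of $$-\Delta_\infty u_k=f_k\ \text{ in }\Omega,\qquad u_k=g\ \text{ on }\partial\Omega.$$ Then there exist a subsequence $\{u_{k_j}\}$ and a viscosity solution $u\in C(\bar\Omega)$ of $$-\Delta_\infty u=f\ \text{ in }\Omega,\qquad u=g\ \text{ on }\partial\Omega$$ such that $u_{k_j}\to u$ uniformly on $\bar\Omega$ as $j\to\infty$.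
   Context: $\Omega\subseteq\mathbb{R}^n$ is a bounded, connected, open set. It is assumed that $\operatorname{diam}(\Omega):=\sup\{d(x,y):x,y\in\bar\Omega\}<\infty$, where $d(x,y)$ is the infimum of the lengths of Lipschitz paths in $\bar\Omega$ joining $x$ to $y$. For a $C^2$ function $\varphi$ near $x$: if $D\varphi(x)\ne0$, $\Delta_\infty^+\varphi(x)=\Delta_\infty^-\varphi(x):=|D\varphi(x)|^{-2}\langle D^2\varphi(x)D\varphi(x),D\varphi(x)\rangle$; if $D\varphi(x)=0$, $\Delta_\infty^+\varphi(x):=\max_{|v|=1}\langle D^2\varphi(x)v,v\rangle$ and $\Delta_\infty^-\varphi(x):=\min_{|v|=1}\langle D^2\varphi(x)v,v\rangle$. An upper semicontinuous $u$ is a viscosity subsolution of $-\Delta_\infty u=f$ in $\Omega$ if, for every polynomial $\varphi$ of degree 2 (at most) and $x_0\in\Omega$ such that $u-\varphi$ has a strict local maximum at $x_0$, $-\Delta_\infty^+\varphi(x_0)\le f(x_0)$. A lower semicontinuous $u$ is a viscosity supersolution if, for every such $\varphi$ and $x_0\in\Omega$ such that $u-\varphi$ has a strict local minimum at $x_0$, $-\Delta_\infty^-\varphi(x_0)\ge f(x_0)$. A viscosity solution is both. (Equivalently, one may use all $\varphi\in C^2$ and non-strict extrema.) *)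

(* Defs.v *)
From HB Require Import structures.
From mathcomp Require Import all_boot all_order all_algebra.
From mathcomp Require Import all_classical all_reals all_analysis.
Set Implicit Arguments.
Unset Strict Implicit.
Unset Printing Implicit Defensive.
Import Order.TTheory GRing.Theory Num.Theory.
Import numFieldNormedType.Exports.
Local Open Scope classical_set_scope.
Local Open Scope ring_scope.

(* MathComp-Analysis, over R : realType.  R^n is 'rV[R]_n.  The library norm
   on 'rV[R]_n is the max-norm; it is used only for notions on which it agrees
   with the Euclidean norm (topology, boundedness, the Lipschitz property).
   Functions on a subset of R^n are total functions whose values outside that
   subset are irrelevant. *)

Section Euclidean.
Context {R : realType} {n : nat}.
Implicit Types (u v : 'rV[R]_n) (A : set 'rV[R]_n) (h : 'rV[R]_n -> R).

Definition inner u v : R := \sum_(i < n) u ord0 i * v ord0 i.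
Definition enorm u : R := Num.sqrt (inner u u).

Definition frontier A : set 'rV[R]_n := closure A `\` interior A.

(* For h continuous on an open set A this is the L^oo(A) norm; h is bounded on
   A iff it is < +oo. *)
Definition sup_norm A h : \bar R := ereal_sup [set `|h x|%:E | x in A].

(* Euclidean length of gamma on [0, 1]: the vector-valued counterpart of
   total_variation. *)
Definition variation_sum (gamma : R -> 'rV[R]_n) (s : seq R) : R :=
  let F := gamma \o nth 0 (0 :: s) in
  \sum_(0 <= i < size s) enorm (F i.+1 - F i).

Definition path_length (gamma : R -> 'rV[R]_n) : \bar R :=
  ereal_sup [set (variation_sum gamma s)%:E | s in itv_partition 0 1].

Definition lipschitz_path A (x y : 'rV[R]_n) (gamma : R -> 'rV[R]_n) : Prop :=
  [/\ [lipschitz gamma t | t in (`[0 : R, 1 : R]%classic : set R^o)],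
      gamma @` `[0, 1]%classic `<=` A, gamma 0 = x & gamma 1 = y].

(* +oo when x and y are not joined by a Lipschitz path in A *)
Definition path_dist A (x y : 'rV[R]_n) : \bar R :=
  ereal_inf [set path_length gamma | gamma in lipschitz_path A x y].

Definition path_diam (Omega : set 'rV[R]_n) : \bar R :=
  ereal_sup [set path_dist (closure Omega) p.1 p.2
            | p in closure Omega `*` closure Omega].

End Euclidean.

Section InfinityLaplacian.
Context {R : realType} {n : nat}.
Implicit Types (phi : 'rV[R]_n -> R) (x v : 'rV[R]_n).

Definition partial (i : 'I_n) phi : 'rV[R]_n -> R :=
  fun x => 'D_(delta_mx ord0 i) phi x.

Definition gradient phi x : 'rV[R]_n := \row_i partial i phi x.

Definition hessian phi x : 'M[R]_n := \matrix_(i, j) partial i (partial j phi) x.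

Definition hess_form phi x v : R := inner (v *m hessian phi x) v.

(* The sup and inf are a max and a min: for 0 < n the Euclidean unit sphere is
   nonempty and compact. *)
Definition inf_laplacian_plus phi x : R :=
  if gradient phi x == 0
  then sup [set hess_form phi x v | v in [set v | enorm v = 1]]
  else (enorm (gradient phi x) ^+ 2)^-1 * hess_form phi x (gradient phi x).

Definition inf_laplacian_minus phi x : R :=
  if gradient phi x == 0
  then inf [set hess_form phi x v | v in [set v | enorm v = 1]]
  else (enorm (gradient phi x) ^+ 2)^-1 * hess_form phi x (gradient phi x).

(* Polynomial functions of degree at most 2; A need not be symmetric. *)
Definition quadratic_poly phi : Prop :=
  exists (c : R) (b : 'rV[R]_n) (A : 'M[R]_n), forall y,
    phi y = c + \sum_(i < n) b ord0 i * y ord0 i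
              + \sum_(i < n) \sum_(j < n) A i j * y ord0 i * y ord0 j.

End InfinityLaplacian.

Section Viscosity.
Context {R : realType} {n : nat}.
Implicit Types (w u f g : 'rV[R]_n -> R) (Omega : set 'rV[R]_n).

Definition strict_local_max w (x0 : 'rV[R]_n) : Prop :=
  \forall y \near x0^', w y < w x0.

Definition strict_local_min w (x0 : 'rV[R]_n) : Prop :=
  \forall y \near x0^', w x0 < w y.

Definition lsc_on Omega u : Prop :=
  lower_semicontinuous (fun x : subspace Omega => (u x)%:E).

Definition usc_on Omega u : Prop := lsc_on Omega (fun x => - u x).

Definition viscosity_subsolution Omega f u : Prop :=
  usc_on Omega u /\
  forall phi x0, quadratic_poly phi -> Omega x0 ->
    strict_local_max (fun y => u y - phi y) x0 ->
    - inf_laplacian_plus phi x0 <= f x0.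

Definition viscosity_supersolution Omega f u : Prop :=
  lsc_on Omega u /\
  forall phi x0, quadratic_poly phi -> Omega x0 ->
    strict_local_min (fun y => u y - phi y) x0 ->
    - inf_laplacian_minus phi x0 >= f x0.

Definition viscosity_solution Omega f u : Prop :=
  viscosity_subsolution Omega f u /\ viscosity_supersolution Omega f u.

Definition dirichlet_solution Omega f g u : Prop :=
  [/\ {within closure Omega, continuous u}, viscosity_solution Omega f u
    & forall x, frontier Omega x -> u x = g x].

End Viscosity.

Definition locally_uniform_cvg {R : realType} {n : nat} (Omega : set 'rV[R]_n)
    (fk : nat -> 'rV[R]_n -> R) (f : 'rV[R]_n -> R) : Prop :=
  forall x, Omega x ->
    exists2 V, nbhs x V & {uniform V `&` Omega, fk @ \oo --> f}.

(* Main.v *)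
Require Import Defs.
From mathcomp Require Import all_boot all_order all_algebra.
From mathcomp Require Import all_classical all_reals all_analysis.
From mathcomp Require Import ring lra.
Import Order.TTheory GRing.Theory Num.Theory.
Import numFieldNormedType.Exports.
Local Open Scope classical_set_scope.
Local Open Scope ring_scope.
Set Implicit Arguments.
Unset Strict Implicit.

(** The theorem is a compactness statement (the [u_k] are equicontinuous and
    bounded, uniformly in [k]) followed by a stability statement (a uniform limit
    of viscosity solutions is a viscosity solution of the limit equation).

    Equicontinuity comes from comparison with cones.  If [-Delta u <= f <= M]
    and [psi(r) = a r - B r^2] is increasing with [B = M + 1], then
    [x |-> psi(|x - p|)] is smooth away from [p], has a nonzero gradient and
    satisfies [-Delta psi = 2 B > M], so [u - psi(|. - p|)] has no maximum in
    [Omega] other than possibly [p].  Hence an estimate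
    [u <= u(p) + e + L |. - p|] on the boundary propagates to the closure with a
    larger slope that depends only on [L], [M] and the Euclidean diameter
    ([cone_comparison]).  The boundary datum [g], being continuous on a compact
    set, has such affine moduli of continuity: for every [e] there is a slope [L]
    ([compact_affine_modulus]).  One use of the comparison, for [-u] with the
    vertex on the boundary, bounds [u] on the boundary by its value at any point
    [x] of the closure; a second use, for [u] with the vertex at [x], gives a
    modulus of continuity on the whole closure ([dirichlet_solution_modulus]).
    It depends on [k] only through the common bound of the [f_k].  It also
    bounds the [u_k], because their values at a boundary point are prescribed.
    The Arzela-Ascoli argument ([arzela_ascoli]) then yields the subsequence.

    For stability ([subsolution_limit]), a strict local maximum of [u - phi] at
    [x0] produces local maxima [z] of [u_k - phi] near [x0], which become strict
    after adding [e |. - z|^2] to [phi].  The gradient of the perturbed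
    polynomial at [z] is close to that of [phi] at [x0] and its second-order part
    is larger by [e] only, so the upper semicontinuity of [Delta^+] with respect
    to the gradient ([ilap_usc]) allows the passage to the limit.  Supersolutions
    reduce to subsolutions by [u |-> -u] ([supersolution_opp]). *)

(** * Euclidean inner product and norm *)

Section InnerProduct.
Context {R : realType} {n : nat}.
Implicit Types (u v w : 'rV[R]_n) (a : R) (A B : 'M[R]_n).

Lemma innerE u v : inner u v = (u *m v^T) ord0 ord0.
Proof. by rewrite mxE; apply: eq_bigr => i _; rewrite mxE. Qed.

Lemma innerC u v : inner u v = inner v u.
Proof. by apply: eq_bigr => i _; rewrite mulrC. Qed.

Lemma innerDl u v w : inner (u + v) w = inner u w + inner v w.
Proof. by rewrite !innerE mulmxDl mxE. Qed.

Lemma innerZl a u v : inner (a *: u) v = a * inner u v.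
Proof. by rewrite !innerE -scalemxAl mxE. Qed.

Lemma innerNl u v : inner (- u) v = - inner u v.
Proof. by rewrite !innerE mulNmx mxE. Qed.

Lemma innerDr u v w : inner u (v + w) = inner u v + inner u w.
Proof. by rewrite innerC innerDl !(innerC u). Qed.

Lemma innerZr a u v : inner u (a *: v) = a * inner u v.
Proof. by rewrite innerC innerZl innerC. Qed.

Lemma innerNr u v : inner u (- v) = - inner u v.
Proof. by rewrite innerC innerNl innerC. Qed.

Lemma inner0l v : inner 0 v = 0.
Proof. by rewrite innerE mul0mx mxE. Qed.

Lemma inner0r v : inner v 0 = 0.
Proof. by rewrite innerC inner0l. Qed.

Lemma inner_tr A u v : inner (u *m A^T) v = inner (v *m A) u.
Proof.
by rewrite [LHS]innerC !innerE trmx_mul trmxK mulmxA.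
Qed.

Lemma inner_mulmx_shift A a u :
  inner (u *m (A + a%:M)) u = inner (u *m A) u + a * inner u u.
Proof. by rewrite mulmxDr mul_mx_scalar innerDl innerZl. Qed.

Lemma inner_delta u i : inner u (delta_mx ord0 i) = u ord0 i.
Proof.
rewrite /inner (bigD1 i)//= big1 ?addr0; first by rewrite mxE !eqxx mulr1.
by move=> j ji; rewrite mxE (negPf ji) andbF mulr0.
Qed.

Lemma inner_ge0 u : 0 <= inner u u.
Proof. by apply: sumr_ge0 => i _; rewrite -expr2 sqr_ge0. Qed.

Lemma inner_gt0 u : u != 0 -> 0 < inner u u.
Proof.
move=> u0; rewrite lt_def inner_ge0 andbT; apply: contra u0 => /eqP uu.
apply/eqP/rowP => i; rewrite mxE.
have /psumr_eq0P := uu => /(_ (fun j _ => sqr_ge0 (u ord0 j))) /(_ i isT).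
by move=> /eqP; rewrite mulf_eq0 orbb => /eqP.
Qed.

Lemma enorm_ge0 u : 0 <= enorm u.
Proof. exact: sqrtr_ge0. Qed.

Lemma sqr_enorm u : enorm u ^+ 2 = inner u u.
Proof. by rewrite sqr_sqrtr ?inner_ge0. Qed.

Lemma enorm_gt0 u : u != 0 -> 0 < enorm u.
Proof. by move=> u0; rewrite sqrtr_gt0 inner_gt0. Qed.

Lemma enorm0 : enorm (0 : 'rV[R]_n) = 0.
Proof. by rewrite /enorm inner0l sqrtr0. Qed.

Lemma enormN u : enorm (- u) = enorm u.
Proof. by rewrite /enorm innerNl innerNr opprK. Qed.

Lemma enormZ a u : 0 <= a -> enorm (a *: u) = a * enorm u.
Proof.
move=> a0; rewrite /enorm innerZl innerZr mulrA sqrtrM ?mulr_ge0//.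
by rewrite -expr2 sqrtr_sqr ger0_norm.
Qed.

Lemma cauchy_schwarz u v : inner u v ^+ 2 <= inner u u * inner v v.
Proof.
have [->|v0] := eqVneq v 0.
  by rewrite !inner0r expr0n mulr0.
have vv := inner_gt0 v0.
have := inner_ge0 (inner v v *: u - inner u v *: v).
rewrite !(innerDl, innerDr, innerNl, innerNr, innerZl, innerZr) (innerC v u).
set a := inner u u; set b := inner v v; set c := inner u v => H.
have : 0 <= b * (a * b - c ^+ 2) by apply: le_trans H _; nra.
by rewrite pmulr_rge0// subr_ge0.
Qed.

Lemma norm_coord u i : `|u ord0 i| <= `|u|.
Proof.
rewrite [leRHS]/Num.norm /= mx_normrE.
exact: (le_bigmax _ (fun ij => `|u ij.1 ij.2|) (ord0, i)).
Qed.

Lemma norm_le_enorm u : `|u| <= enorm u.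
Proof.
rewrite [leLHS]/Num.norm /= mx_normrE; apply: bigmax_le; first exact: enorm_ge0.
move=> [i j] _ /=; rewrite (ord1 i) -sqrtr_sqr ler_sqrt ?inner_ge0//.
rewrite /inner (bigD1 j)//= -expr2 lerDl.
by apply: sumr_ge0 => k _; rewrite -expr2 sqr_ge0.
Qed.

Lemma enorm_le_norm u : enorm u <= n%:R * `|u|.
Proof.
have nu : 0 <= n%:R * `|u| by apply: mulr_ge0.
rewrite -(ger0_norm nu) -sqrtr_sqr ler_sqrt ?sqr_ge0//.
rewrite exprMn; apply: (@le_trans _ _ (\sum_(i < n) `|u| ^+ 2)).
  apply: ler_sum => i _; rewrite -expr2 -[leLHS]real_normK ?num_real//.
  by rewrite ler_pXn2r ?nnegrE// norm_coord.
rewrite sumr_const card_ord -[leLHS]mulr_natl; apply: ler_wpM2r; first exact: sqr_ge0.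
by rewrite -natrX ler_nat expnS expn1; case: (n) => // m; rewrite leq_pmulr.
Qed.

Lemma cvg_inner (T : Type) (F : set_system T) {FF : Filter F}
    (f h : T -> 'rV[R]_n) u v :
  f @ F --> u -> h @ F --> v -> (fun x => inner (f x) (h x)) @ F --> inner u v.
Proof.
move=> fu hv; apply: cvg_big => [|i _]; first exact: add_continuous.
apply: cvgM.
- exact: (cvg_comp _ (fun M : 'rV[R]_n => M ord0 i) fu
    (@coord_continuous R 1 n ord0 i u)).
- exact: (cvg_comp _ (fun M : 'rV[R]_n => M ord0 i) hv
    (@coord_continuous R 1 n ord0 i v)).
Qed.

(** A neighbourhood of a row vector is a product of neighbourhoods of its
    entries, so that convergence is entrywise. *)
Lemma cvg_rowvec (T : Type) (F : set_system T) {FF : Filter F}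
    (f : T -> 'rV[R]_n) u :
  (forall i, f x ord0 i @[x --> F] --> u ord0 i) -> f @ F --> u.
Proof.
move=> fu A [E uE EA]; apply: filterS (_ : F [set x | forall i j, E i j (f x i j)]).
  by move=> x; exact: EA.
apply: filter_forall => i; apply: filter_forall => j.
by rewrite (ord1 i); apply: fu; have := uE ord0 j.
Qed.

Lemma cvg_mulmxr (T : Type) (F : set_system T) {FF : Filter F}
    (f : T -> 'rV[R]_n) u A :
  f @ F --> u -> f x *m A @[x --> F] --> u *m A.
Proof.
move=> fu; apply: cvg_rowvec => j; rewrite mxE.
under eq_cvg do rewrite mxE.
apply: cvg_big => [|i _]; first exact: add_continuous.
apply: cvgM; last exact: cvg_cst.
exact: (cvg_comp _ (fun M : 'rV[R]_n => M ord0 i) fu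
    (@coord_continuous R 1 n ord0 i u)).
Qed.

Lemma enorm_continuous : continuous (enorm : 'rV[R]_n -> R).
Proof.
move=> x; apply: (cvg_comp (fun y => inner y y) (@Num.sqrt R)).
  exact: (@cvg_inner _ (nbhs x) _ id id x x cvg_id cvg_id).
exact: sqrt_continuous.
Qed.

End InnerProduct.

(** * Calculus of quadratic polynomials *)

Section Quadratics.
Context {R : realType} {n : nat}.
Implicit Types (p u v x y z : 'rV[R]_n) (a c d : R) (A B : 'M[R]_n).

(** The base point [z] is kept explicit because the proofs expand the same
    polynomial at several points: at its own base point, [c], [p] and [A] are the
    value, the gradient and half the Hessian up to symmetrization. *)
Definition quad z c p A y : R :=
  c + inner p (y - z) + inner ((y - z) *m A) (y - z).

Lemma quad_at z c p A : quad z c p A z = c.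
Proof. by rewrite /quad subrr mul0mx !inner0r !addr0. Qed.

(** This is the exact second-order Taylor formula. *)
Lemma quad_recenter z' z c p A :
  quad z c p A = quad z' (quad z c p A z') (p + (z' - z) *m (A + A^T)) A.
Proof.
apply/funext => y; rewrite /quad.
have -> : y - z = (y - z') + (z' - z) by rewrite addrA subrK.
move: (y - z') (z' - z) => h d.
rewrite !(mulmxDl, mulmxDr, innerDl, innerDr) inner_tr; ring.
Qed.

Lemma quad_opp z c p A : (fun y => - quad z c p A y) = quad z (- c) (- p) (- A).
Proof.
by apply/funext => y; rewrite /quad mulmxN !innerNl !opprD.
Qed.

Lemma quadratic_polyP (phi : 'rV[R]_n -> R) :
  quadratic_poly phi <-> exists c p A, phi = quad 0 c p A.
Proof.
have E c p A y : quad 0 c p A y = c + \sum_(i < n) p ord0 i * y ord0 i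
              + \sum_(i < n) \sum_(j < n) A i j * y ord0 i * y ord0 j.
  rewrite /quad subr0; congr (_ + _); rewrite exchange_big/=.
  apply: eq_bigr => j _; rewrite mxE mulr_suml; apply: eq_bigr => i _.
  by rewrite (mulrC (A i j)).
split=> [[c [p [A phiE]]]|[c [p [A ->]]]]; exists c, p, A => //.
by apply/funext => y; rewrite phiE E.
Qed.

Lemma quadratic_quad z c p A : quadratic_poly (quad z c p A).
Proof.
by apply/quadratic_polyP; rewrite (quad_recenter 0); do 3 eexists.
Qed.

(** Once [quad] is expanded at [x], the difference quotient along [v] is the
    affine function [h |-> <q, v> + h <v A, v>] of [h]. *)
Lemma derive_quad z c p A x v :
  'D_v (quad z c p A) x = inner (p + (x - z) *m (A + A^T)) v.
Proof.
rewrite (quad_recenter x).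
set q := p + _ ; set e := quad z c p A x; apply: cvg_lim => //.
apply: (@cvg_trans _ ((fun h => inner q v + h * inner (v *m A) v) @ (0 : R)^')).
  apply: near_eq_cvg; near=> h.
  have h0 : h != 0 by near: h; exact: nbhs_dnbhs_neq.
  rewrite /= quad_at /quad addrK -scalemxAl !innerZl !innerZr /GRing.scale/=.
  by field.
have hq : h * inner (v *m A) v @[h --> (0 : R)^'] --> 0 * inner (v *m A) v.
  by apply: cvgM; [exact: nbhs_dnbhs | exact: cvg_cst].
have := cvgD (cvg_cst (inner q v)) hq; rewrite mul0r addr0 => H. exact: H.
Unshelve. all: by end_near. Qed.

Lemma gradient_quad z c p A x :
  gradient (quad z c p A) x = p + (x - z) *m (A + A^T).
Proof. by apply/rowP => i; rewrite mxE /partial derive_quad inner_delta. Qed.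

Lemma hessian_quad z c p A x : hessian (quad z c p A) x = A + A^T.
Proof.
apply/matrixP => i j; rewrite mxE.
(* The partial derivative is affine, hence again of the form [quad], and
   [derive_quad] applies a second time. *)
have -> : partial j (quad z c p A) =
    quad z (p ord0 j) (delta_mx ord0 j *m (A + A^T)^T) 0.
  apply/funext => y; rewrite /partial derive_quad /quad mulmx0 inner0l addr0.
  by rewrite innerDl inner_delta inner_tr.
rewrite /partial derive_quad trmx0 addr0 mulmx0 addr0 inner_tr inner_delta.
by rewrite -rowE mxE.
Qed.

Lemma hess_form_quad z c p A x v :
  hess_form (quad z c p A) x v = 2 * inner (v *m A) v.
Proof.
rewrite /hess_form hessian_quad mulmxDr innerDl inner_tr; ring.
Qed.

End Quadratics.

(** * The infinity Laplacian of a quadratic polynomial *)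

Section InfinityLaplacianQuad.
Context {R : realType} {n : nat}.
Implicit Types (p q u v x y z : 'rV[R]_n) (a c d : R) (A B : 'M[R]_n).

Definition form_sphere A : set R :=
  [set 2 * inner (v *m A) v | v in [set v | enorm v = 1]].

(** The operator [Delta^+] as a function of the gradient [q] and of the matrix [A]
    of the quadratic part; the factor 2 is there because the Hessian is
    [A + A^T]. *)
Definition ilap A q : R :=
  if q == 0 then sup (form_sphere A)
  else (enorm q ^+ 2)^-1 * (2 * inner (q *m A) q).

Lemma inf_laplacian_plus_quad z c p A x :
  inf_laplacian_plus (quad z c p A) x = ilap A (p + (x - z) *m (A + A^T)).
Proof.
rewrite /inf_laplacian_plus gradient_quad hess_form_quad /ilap /form_sphere.
by under eq_imagel do rewrite hess_form_quad.
Qed.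

Lemma inf_laplacian_minus_quad z c p A x :
  inf_laplacian_minus (quad z c p A) x =
  - inf_laplacian_plus (fun y => - quad z c p A y) x.
Proof.
rewrite quad_opp inf_laplacian_plus_quad /inf_laplacian_minus gradient_quad.
rewrite hess_form_quad /ilap linearN/= -opprD mulmxN -opprD oppr_eq0.
case: ifP => _; last by rewrite enormN mulNmx mulmxN opprK innerNr !mulrN opprK.
rewrite /inf; congr (- sup _); rewrite image_comp; apply: eq_imagel => v _ /=.
by rewrite hess_form_quad mulmxN innerNl mulrN.
Qed.

Lemma has_ubound_form A : has_ubound (form_sphere A).
Proof.
exists (2 * \sum_j \sum_i `|A i j|) => _ [v /= v1 <-].
rewrite ler_pM2l//; apply: ler_sum => j _; rewrite mxE mulr_suml.
apply: ler_sum => i _; rewrite (mulrC (v _ _)) -mulrA.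
apply: (le_trans (ler_norm _)); rewrite normrM ler_piMr//.
have vj k : `|v ord0 k| <= 1.
  by rewrite -v1 (le_trans (norm_coord _ _))// norm_le_enorm.
by rewrite normrM mulr_ile1.
Qed.

(** When [q] is nonzero, [ilap A q] is the value of the form at the unit vector
    [q / |q|]. *)
Lemma ilap_le_sup A q : ilap A q <= sup (form_sphere A).
Proof.
rewrite /ilap; case: (eqVneq q 0) => // q0.
have nq := enorm_gt0 q0.
apply: ub_le_sup; first exact: has_ubound_form.
exists ((enorm q)^-1 *: q) => /=.
  by rewrite enormZ ?invr_ge0 ?ltW// mulVf ?gt_eqF.
rewrite -scalemxAl innerZl innerZr; field.
by rewrite gt_eqF.
Qed.

Lemma sup_form_shift A d : 0 <= d ->
  sup (form_sphere (A + d%:M)) <= sup (form_sphere A) + 2 * d.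
Proof.
move=> d0; have [[v0 v01]|S0] := pselect ([set v : 'rV[R]_n | enorm v = 1] !=set0).
  apply: ge_sup; first by exists (2 * inner (v0 *m (A + d%:M)) v0), v0.
  move=> _ [v /= v1 <-].
  rewrite inner_mulmx_shift -sqr_enorm v1 expr1n mulr1 mulrDr.
  rewrite lerD2r; apply: ub_le_sup; first exact: has_ubound_form.
  by exists v.
(* Without unit vectors, that is for [n = 0], both suprema are those of the empty
   set, which are [0]. *)
have S0' : [set v : 'rV[R]_n | enorm v = 1] = set0.
  by rewrite -subset0 => v vS; apply: S0; exists v.
by rewrite /form_sphere S0' !image_set0 sup0 add0r mulr_ge0.
Qed.

(** At [q0 != 0] the operator is continuous in [q].  At [q0 = 0] it is only upper
    semicontinuous: its value there is the maximum of the form over all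
    directions, which dominates the values at all other gradients. *)
Lemma ilap_usc (T : Type) (F : set_system T) {FF : Filter F} A (q : T -> 'rV[R]_n)
    (q0 : 'rV[R]_n) d e : 0 <= d -> 0 < e -> q @ F --> q0 ->
  \forall x \near F, ilap (A + d%:M) (q x) <= ilap A q0 + 2 * d + e.
Proof.
move=> d0 e0 qq0; have [q00|q00] := eqVneq q0 0.
  apply: nearW => x; apply: (le_trans (ilap_le_sup _ _)).
  apply: (le_trans (sup_form_shift A d0)).
  by rewrite /ilap q00 eqxx lerDl ltW.
have n0 : enorm q0 ^+ 2 != 0 by rewrite expf_neq0// gt_eqF// enorm_gt0.
have cn : enorm (q x) @[x --> F] --> enorm q0.
  exact: (cvg_comp _ _ qq0 (@enorm_continuous _ _ q0)).
have cq : (enorm (q x) ^+ 2)^-1 * (2 * inner (q x *m A) (q x)) @[x --> F]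
    --> ilap A q0.
  rewrite /ilap (negPf q00); apply: cvgM.
    by apply: cvgV => //; rewrite expr2; under eq_cvg do rewrite expr2; exact: cvgM.
  by apply: cvgM; [exact: cvg_cst | apply: cvg_inner => //; exact: cvg_mulmxr].
have qn0 : \forall x \near F, 0 < enorm (q x).
  by apply: (cvgr_gt (enorm q0)) => //; exact: enorm_gt0.
near=> x.
have qx0 : 0 < enorm (q x) by near: x.
have qx : q x != 0.
  by apply: contraTneq qx0 => ->; rewrite enorm0 ltxx.
rewrite {1}/ilap (negPf qx) inner_mulmx_shift mulrDr mulrDr.
rewrite -sqr_enorm (_ : _^-1 * (2 * (d * _)) = 2 * d); last first.
  by field; rewrite gt_eqF.
rewrite addrAC lerD2r; near: x.
by apply: (cvgr_le (ilap A q0)) => //; rewrite ltrDl.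
Unshelve. all: by end_near. Qed.

End InfinityLaplacianQuad.

Section Viscosity.
Context {R : realType} {n : nat}.
Implicit Types (u f : 'rV[R]_n -> R) (Omega : set 'rV[R]_n).

Lemma lsc_on_continuous Omega u : {within Omega, continuous u} -> lsc_on Omega u.
Proof.
move=> cu x a; rewrite lte_fin => aux.
exists [set y | a < u y]; last by move=> y /=; rewrite lte_fin.
by apply: (cvgr_gt (u x)) => //; exact: cu.
Qed.

Lemma quadratic_poly_opp phi :
  quadratic_poly phi -> quadratic_poly (fun y : 'rV[R]_n => - phi y).
Proof.
move=> /quadratic_polyP[c [p [A ->]]]; rewrite quad_opp; exact: quadratic_quad.
Qed.

Lemma inf_laplacian_minus_opp phi (x : 'rV[R]_n) : quadratic_poly phi ->
  inf_laplacian_minus phi x = - inf_laplacian_plus (fun y => - phi y) x.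
Proof. by move=> /quadratic_polyP[c [p [A ->]]]; exact: inf_laplacian_minus_quad. Qed.

(** The identity [Delta^- phi = - Delta^+ (- phi)] exchanges the two halves of the
    definition of a viscosity solution. *)
Lemma supersolution_opp Omega f u :
  viscosity_supersolution Omega f u <->
  viscosity_subsolution Omega (fun x => - f x) (fun x => - u x).
Proof.
rewrite /viscosity_subsolution /viscosity_supersolution /usc_on.
have -> : (fun x => - - u x) = u by apply/funext => x; rewrite opprK.
split=> -[lu H]; split=> // phi x0 qphi Ox0 locm.
  have := H _ x0 (quadratic_poly_opp qphi) Ox0.
  rewrite inf_laplacian_minus_opp; last exact: quadratic_poly_opp.
  have -> : (fun y => - - phi y) = phi by apply/funext => x; rewrite opprK.
  rewrite opprK lerNr opprK; apply.
  by apply: filterS locm => y /=; lra.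
rewrite inf_laplacian_minus_opp// opprK -lerN2.
apply: H => //; first exact: quadratic_poly_opp.
by apply: filterS locm => y /=; lra.
Qed.

End Viscosity.

(** * Comparison with concave cones *)

Section ConeComparison.
Context {R : realType} {n : nat}.
Implicit Types (u f : 'rV[R]_n -> R) (Omega : set 'rV[R]_n).
Implicit Types (p q v x y z h : 'rV[R]_n) (a c d e al be L D M : R) (A : 'M[R]_n).

(** The matrix is a multiple of the identity corrected in the single direction
    [v]. *)
Lemma inner_rank_one al be v h :
  inner (h *m (al%:M - be *: (v^T *m v))) h = al * inner h h - be * inner v h ^+ 2.
Proof.
rewrite mulmxBr mul_mx_scalar -scalemxAr mulmxA innerDl innerNl !innerZl.
by rewrite [h *m _]mx11_scalar -innerE mul_scalar_mx innerZl (innerC h v).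
Qed.

Lemma subr_right_cvg x p : y - p @[y --> x] --> x - p.
Proof.
exact: (@cvgB _ _ _ (nbhs x) _ id (cst p) x p cvg_id (cvg_cst p)).
Qed.

(** The definition of a subsolution, read for a test polynomial given by its
    Taylor expansion at the contact point. *)
Lemma subsolution_test Omega f u z q A :
  viscosity_subsolution Omega f u -> Omega z ->
  (\forall y \near z^', u y - u z < inner q (y - z) + inner ((y - z) *m A) (y - z)) ->
  - ilap A q <= f z.
Proof.
move=> [_ subu] Oz uz.
have := subu _ z (quadratic_quad z 0 q A) Oz.
rewrite inf_laplacian_plus_quad subrr mul0mx addr0; apply.
by apply: filterS uz => y; rewrite quad_at /quad; lra.
Qed.

(** With [r = |z|], [rho = |z + h|], [t] the component of [h] along [z] and
    [s = |h|^2], this bounds the distance function from above by a quadratic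
    polynomial that touches it at [h = 0] and whose second derivative in the
    radial direction vanishes.  It follows from
    [rho^2 = (r + t)^2 + (s - t^2)] and [sqrt (a^2 + q) <= a + q / (2 a)] for
    [a = r + t >= r / 2]. *)
Lemma cone_tangent (rho r t s : R) : 0 < r -> 0 <= rho -> - (r / 2) <= t ->
  t ^+ 2 <= s -> rho ^+ 2 = r ^+ 2 + 2 * r * t + s ->
  rho <= r + t + (s - t ^+ 2) / r.
Proof.
move=> r0 rho0 tr ts rhoE; set k := (s - t ^+ 2) / r.
have k0 : 0 <= k by rewrite divr_ge0 ?subr_ge0 ?(ltW r0).
have kr : k * r = s - t ^+ 2 by rewrite /k divfK ?gt_eqF.
have m0 : 0 <= r + t + k by nra.
have tk : 0 <= (t + r / 2) * k by rewrite mulr_ge0// -lerBlDr sub0r.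
by rewrite -(ler_pXn2r (ltn0Sn 1)) ?nnegrE// rhoE; nra.
Qed.

(** If the maximum of [u - psi(|. - p|)], with
    [psi(r) = a r - B r^2] and [a = L + 2 B D], were above [u p + e], then it would
    be attained at a point [x0] of [Omega] different from [p].  The quadratic
    polynomial of [cone_tangent] turns [psi(|. - p|)] into a test polynomial at
    [x0] whose second derivative along its nonzero gradient is [- 2 B + 1].  The
    equation gives [2 B - 1 <= M], which is false for [B = M + 1]. *)
Lemma cone_comparison Omega f u p L D M e :
  open Omega -> compact (closure Omega) ->
  {within closure Omega, continuous u} -> viscosity_subsolution Omega f u ->
  0 <= M -> (forall x, Omega x -> f x <= M) ->
  closure Omega p -> (forall x, closure Omega x -> enorm (x - p) <= D) ->
  0 < L -> 0 <= e ->
  (forall y, frontier Omega y -> u y <= u p + e + L * enorm (y - p)) ->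
  forall x, closure Omega x -> u x <= u p + e + (L + 2 * (M + 1) * D) * enorm (x - p).
Proof.
move=> oO cK cu subu M0 fM Kp KD L0 e0 ub.
set B := M + 1; set a := L + 2 * B * D.
have B0 : 0 < B by rewrite ltr_wpDl.
pose w y := u y - a * enorm (y - p) + B * enorm (y - p) ^+ 2.
have cw : {within closure Omega, continuous w}.
  have cr : {within closure Omega, continuous (fun y => enorm (y - p))}.
    apply: continuous_subspaceT => y.
    have yp : z - p @[z --> y] --> y - p by exact: subr_right_cvg.
    exact: (cvg_comp _ _ yp (@enorm_continuous _ _ _)).
  move=> y; apply: cvgD.
    by apply: cvgB; [exact: cu | apply: cvgM; [exact: cvg_cst | exact: cr]].
  by apply: cvgM; [exact: cvg_cst | apply: cvgM; exact: cr].
have [x0 /set_mem Kx0 x0max] := compact_EVT_max (ex_intro _ p Kp) cK cw.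
suff wx0 : w x0 <= u p + e.
  move=> x Kx; have := x0max x (mem_set Kx); rewrite {1}/w => wx.
  have : 0 <= B * enorm (x - p) ^+ 2 by rewrite mulr_ge0 ?sqr_ge0 ?ltW.
  by lra.
rewrite leNgt; apply/negP => wx0.
have D0 : 0 <= D by apply: le_trans (KD p Kp); exact: enorm_ge0.
have x0p : x0 - p != 0.
  apply: contraTneq wx0 => x0p.
  rewrite /w x0p enorm0 expr0n !mulr0 subr0 addr0 -leNgt.
  by move/eqP : x0p; rewrite subr_eq0 => /eqP ->; rewrite lerDl.
set r := enorm (x0 - p) in wx0 *.
have r0 : 0 < r by exact: enorm_gt0.
have rD : r <= D by exact: KD.
(* On the frontier the hypothesis applies, since [L r <= a r - B r^2] for
   [0 <= r <= D]. *)
have Ox0 : Omega x0.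
  apply: contrapT => nOx0; have := ub x0.
  have fx0 : frontier Omega x0 by split => // /interior_subset.
  move=> /(_ fx0); move: wx0; rewrite /w -/r /a.
  have : 0 <= B * r * (D - r) by rewrite !mulr_ge0// ?subr_ge0// ltW.
  have : 0 <= B * r * D by rewrite !mulr_ge0// ltW.
  by nra.
set v := r^-1 *: (x0 - p).
have vv : inner v v = 1.
  rewrite innerZl innerZr -sqr_enorm -/r; field; exact: lt0r_neq0.
have xp : x0 - p = r *: v by rewrite scalerA mulfV ?scale1r ?gt_eqF.
clearbody v.
(* [A] collects the second-order terms of the quadratic bound for [psi].  The
   term [2^-1] makes the contact strict; it adds [1] to the second
   derivative. *)
pose al := a / r - B + 2^-1; pose be := a / r.
pose A : 'M[R]_n := al%:M - be *: (v^T *m v).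
have formA h : inner (h *m A) h = al * inner h h - be * inner v h ^+ 2.
  exact: inner_rank_one.
(* The number [a - 2 B r] is [psi'(r)], so that the gradient of the test
   polynomial does not vanish. *)
have ga : 0 < a - 2 * B * r.
  have : 0 <= B * (D - r) by rewrite mulr_ge0 ?subr_ge0// ltW.
  by rewrite /a; nra.
have : - ilap A ((a - 2 * B * r) *: v) <= f x0.
  apply: (subsolution_test subu Ox0).
  have cK0 : \forall y \near x0^', closure Omega y.
    apply: nbhs_dnbhs; apply: filterS (open_nbhs_nbhs (conj oO Ox0)).
    exact: subset_closure.
  have ct : \forall y \near x0^', - (r / 2) < inner v (y - x0).
    have vc : inner v (y - x0) @[y --> x0] --> inner v (x0 - x0).
      exact: (cvg_inner (cvg_cst v) (@subr_right_cvg x0 x0)).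
    apply: nbhs_dnbhs; apply: (cvgr_gt _ vc).
    by rewrite subrr inner0r oppr_lt0 divr_gt0.
  near=> y.
  have yx0 : y - x0 != 0 by rewrite subr_eq0; near: y; exact: nbhs_dnbhs_neq.
  have Ky : closure Omega y by near: y.
  have ty : - (r / 2) < inner v (y - x0) by near: y.
  rewrite formA innerZl.
  have rhoE : enorm (y - p) ^+ 2 =
      r ^+ 2 + 2 * r * inner v (y - x0) + inner (y - x0) (y - x0).
    rewrite sqr_enorm (_ : y - p = (y - x0) + (x0 - p)); last first.
      by rewrite addrA subrK.
    rewrite xp; move: (y - x0) => h.
    by rewrite !(innerDl, innerDr, innerZl, innerZr) vv (innerC h); ring.
  have cs : inner v (y - x0) ^+ 2 <= inner (y - x0) (y - x0).
    by have := cauchy_schwarz v (y - x0); rewrite vv mul1r.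
  have := cone_tangent r0 (enorm_ge0 (y - p)) (ltW ty) cs rhoE.
  have := x0max y (mem_set Ky); rewrite /w -/r rhoE.
  have := inner_gt0 yx0; move: cs => _ {rhoE}.
  set s := inner (y - x0) _; set t := inner v _; set rho := enorm _.
  rewrite /al /be => s0 uy ht.
  have : a * rho <= a * (r + t + (s - t ^+ 2) / r).
    by rewrite ler_pM2l//; move: ga; nra.
  have : a * ((s - t ^+ 2) / r) = a / r * s - a / r * t ^+ 2 by ring.
  by nra.
rewrite /ilap scaler_eq0 gt_eqF//=.
case: eqP => [v0|_].
  by move: vv; rewrite v0 inner0l => /eqP; rewrite eq_sym oner_eq0.
rewrite formA sqr_enorm !(innerZl, innerZr) vv.
have -> : ((a - 2 * B * r) * ((a - 2 * B * r) * 1))^-1 *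
   (2 * (al * ((a - 2 * B * r) * ((a - 2 * B * r) * 1)) -
    be * ((a - 2 * B * r) * 1) ^+ 2)) = 2 * (al - be).
  by field; rewrite gt_eqF.
have := fM _ Ox0; rewrite /al /be /B; lra.
Unshelve. all: by end_near. Qed.

End ConeComparison.

(** * Stability of subsolutions under uniform convergence *)

Section Stability.
Context {R : realType} {n : nat}.
Implicit Types (u f : 'rV[R]_n -> R) (Omega : set 'rV[R]_n).
Implicit Types (p q v x y z h : 'rV[R]_n) (a c d e L D M r : R) (A : 'M[R]_n).

Lemma norm_subr_continuous x : continuous (fun y : 'rV[R]_n => `|y - x|).
Proof. by move=> y; exact: (cvg_norm (@subr_right_cvg _ _ y x)). Qed.

Lemma compact_norm_preimage x r (S : set R) : closed S -> S `<=` [set t | t <= r] ->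
  compact [set y | S `|y - x|].
Proof.
move=> cS Sr; apply: bounded_closed_compact.
  exists (r + `|x|); split; first exact: num_real.
  move=> M rM y /Sr /= yr; rewrite -(subrK x y).
  by rewrite (le_trans (ler_normD _ _))// (le_trans _ (ltW rM))// lerD2r.
exact: ((continuous_closedP _).1 (@norm_subr_continuous x) S cS).
Qed.

Lemma quad_continuous z c p A : continuous (quad z c p A).
Proof.
move=> x; have xz := @subr_right_cvg R n x z.
have h1 : inner p (y - z) @[y --> x] --> inner p (x - z).
  exact: (cvg_inner (cvg_cst p) xz).
have h2 : inner ((y - z) *m A) (y - z) @[y --> x] --> inner ((x - z) *m A) (x - z).
  exact: (cvg_inner (cvg_mulmxr xz) xz).
exact: (cvgD (cvgD (cvg_cst c) h1) h2).
Qed.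

Lemma strict_max_gap (w : 'rV[R]_n -> R) (S : set 'rV[R]_n) (m : R) :
  compact S -> {within S, continuous w} -> (forall y, S y -> w y < m) ->
  exists2 eta, 0 < eta & forall y, S y -> w y + eta <= m.
Proof.
move=> cS cw wm; have [S0|S0] := pselect (S !=set0); last first.
  by exists 1 => // y Sy; exfalso; apply: S0; exists y.
have [y0 /set_mem Sy0 y0max] := compact_EVT_max S0 cS cw.
exists (m - w y0); first by rewrite subr_gt0 wm.
by move=> y Sy; rewrite -lerBrDr opprB addrCA subrr addr0 y0max// mem_set.
Qed.

(** A strict local maximum [x0] of [u - phi] is the strict maximum over a small
    closed ball, with a positive gap on its boundary sphere.  As soon as
    [|u_k - u|] is below half of that gap, the maximum of [u_k - phi] over the ball
    is attained at an interior point [z], and [phi + e |. - z|^2] is a test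
    polynomial for [u_k] there. *)
Lemma subsolution_limit Omega f u (fk uk : nat -> 'rV[R]_n -> R) :
  open Omega ->
  (forall k, {within Omega, continuous (uk k)}) -> {within Omega, continuous u} ->
  (forall k, viscosity_subsolution Omega (fk k) (uk k)) ->
  (forall x e, Omega x -> 0 < e ->
    \forall y \near x & k \near \oo, Omega y -> fk k y < f x + e) ->
  (forall e, 0 < e ->
    \forall k \near \oo, forall x, Omega x -> `|uk k x - u x| < e) ->
  viscosity_subsolution Omega f u.
Proof.
move=> oO cuk cu subk fkf uku; split.
  by apply: lsc_on_continuous => x; apply: cvgN; exact: cu.
move=> phi x0 /quadratic_polyP[c [p [A ->{phi}]]] Ox0 maxx0.
apply/ler_addgt0Pr => e' e'0.
(* The errors add up to [4 e]: one [e] from [f_k], and [2 e + e] from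
   [ilap_usc]. *)
pose e := e' / 4; have e0 : 0 < e by rewrite divr_gt0.
rewrite inf_laplacian_plus_quad.
pose q z := p + (z - 0) *m (A + A^T).
have [[/= N1 N2] [N1x0 N2oo] N12] := fkf x0 e Ox0 e0.
have Nx0 : \forall y \near x0, [/\ Omega y, N1 y,
    y != x0 -> u y - quad 0 c p A y < u x0 - quad 0 c p A x0 &
    ilap (A + e%:M) (q y) <= ilap A (q x0) + 2 * e + e].
  near=> y; split.
  - by near: y; exact: open_nbhs_nbhs.
  - by near: y.
  - by near: y; have := maxx0; rewrite /strict_local_max /dnbhs nearE withinE.
  - near: y; apply: ilap_usc => //; first exact: ltW.
    apply: cvgD; first exact: cvg_cst.
    apply: cvg_mulmxr; exact: subr_right_cvg.
have [r0 /= r00 r0N] := (nbhs_ballP _ _).1 Nx0.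
pose r := r0 / 2; have r_gt0 : 0 < r by rewrite divr_gt0.
have {r0N}rN y : `|y - x0| <= r -> [/\ Omega y, N1 y,
    y != x0 -> u y - quad 0 c p A y < u x0 - quad 0 c p A x0 &
    ilap (A + e%:M) (q y) <= ilap A (q x0) + 2 * e + e].
  move=> yr; apply: r0N; rewrite mx_norm_ball /ball_ /= distrC (le_lt_trans yr)//.
  by rewrite /r ltr_pdivrMr// ltr_pMr// ltr1n.
pose phi := quad 0 c p A.
have cB : compact [set y | `|y - x0| <= r].
  by apply: (@compact_norm_preimage x0 r [set t | t <= r]) => //; exact: closed_le.
have cS : compact [set y | `|y - x0| = r].
  apply: (@compact_norm_preimage x0 r [set t | t = r]); first exact: closed_eq.
  by move=> t ->/=.
have cphi (S : set 'rV[R]_n) (v : 'rV[R]_n -> R) : S `<=` Omega ->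
    {within Omega, continuous v} ->
    {within S, continuous (fun y => v y - phi y)}.
  move=> SO cv; apply: continuous_subspaceW SO _ => y.
  by apply: cvgB; [exact: cv | exact: (continuous_subspaceT (@quad_continuous _ _ _ _))].
have SO : [set y | `|y - x0| = r] `<=` Omega.
  by move=> y /= yr; have [] := rN y; rewrite ?yr.
have BO : [set y | `|y - x0| <= r] `<=` Omega by move=> y /= /rN[].
have [|eta eta0 etaS] := strict_max_gap (m := u x0 - phi x0) cS (cphi _ _ SO cu).
  move=> y /= yr; have [|_ _ + _] := rN y; [by rewrite yr | apply].
  by apply: contra_eq_neq yr => ->; rewrite subrr normr0 lt_eqF.
have eta20 : 0 < eta / 2 by rewrite divr_gt0.
have [k [N2k ukk]] : exists k, N2 k /\ forall x, Omega x -> `|uk k x - u x| < eta / 2.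
  have := filter_ex (filterI N2oo (uku _ eta20)).
  by move=> [k [? ?]]; exists k.
have B0 : [set y | `|y - x0| <= r] !=set0.
  by exists x0; rewrite /= subrr normr0 ltW.
have [z /set_mem /= zB zmax] := compact_EVT_max B0 cB (cphi _ _ BO (cuk k)).
have zr : `|z - x0| < r.
  rewrite lt_neqAle zB andbT; apply/eqP => zr.
  have := zmax x0; rewrite inE /= subrr normr0 ltW// => /(_ isT).
  have := etaS z zr; have := ukk _ Ox0; have := ukk z (SO _ zr).
  by rewrite !ltr_norml => /andP[? ?] /andP[? ?]; lra.
have [Oz N1z _ ilapz] := rN z zB.
have : - ilap (A + e%:M) (q z) <= fk k z.
  apply: (subsolution_test (subk k) Oz); near=> y.
  have yB : `|y - x0| <= r.
    apply: ltW; near: y; apply: nbhs_dnbhs.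
    exact: (cvgr_lt _ (@norm_subr_continuous x0 z)).
  have yz : y - z != 0 by rewrite subr_eq0; near: y; exact: nbhs_dnbhs_neq.
  rewrite inner_mulmx_shift.
  have := zmax y (mem_set yB).
  rewrite /phi (quad_recenter z) -/(q z) quad_at /quad.
  have : 0 < e * inner (y - z) (y - z) by rewrite mulr_gt0// inner_gt0.
  by lra.
have := N12 (z, k) (conj N1z N2k) Oz => /= fz.
by rewrite -/(q x0); move: fz ilapz; rewrite /e; lra.
Unshelve. all: by end_near. Qed.

End Stability.

(** * Extraction of a uniformly convergent subsequence *)

Section ArzelaAscoli.
Context {R : realType} {X : topologicalType}.

(** Maximality is tested by [in_ultra_setVsetC]: a set whose preimage is not in the
    ultrafilter has a complement whose preimage is. *)
Lemma ultra_fmap (S T : Type) (F : set_system S) (h : S -> T) :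
  UltraFilter F -> UltraFilter (h @ F).
Proof.
move=> FU; split=> [|G GG FG]; first exact: fmap_proper_filter.
apply/seteqP; split=> // A GA.
have [//|FnA] := in_ultra_setVsetC (h @^-1` A) FU.
have GnA : G (~` A) by apply: FG.
by have [? []] := filter_ex (filterI GA GnA).
Qed.

Lemma extract_subsequence (P : R -> nat -> Prop) :
  (forall e e' k, e <= e' -> P e k -> P e' k) ->
  (forall e N, 0 < e -> exists2 k, (N <= k)%N & P e k) ->
  exists2 s : nat -> nat, {homo s : i j / (i < j)%N} &
    forall e, 0 < e -> \forall j \near \oo, P e (s j).
Proof.
move=> Pmono Pex.
have [h hP] : exists h : nat -> nat -> nat,
    forall N i, (N <= h N i)%N /\ P (i.+1%:R^-1) (h N i).
  have E N i : exists k, (N <= k)%N /\ P (i.+1%:R^-1) k.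
    by have [|k ? ?] := Pex (i.+1%:R^-1) N; [rewrite invr_gt0 | exists k].
  have [h hP] := choice (fun Ni : nat * nat => E Ni.1 Ni.2).
  by exists (fun N i => h (N, i)) => N i; exact: hP (N, i).
pose s := fix s j := if j is i.+1 then h (s i).+1 j else h 0%N 0%N.
have sP j : P (j.+1%:R^-1) (s j).
  by case: j => [|j]; [exact: (hP 0 0)%N.2 | exact: (hP (s j).+1 j.+1).2].
exists s.
  by apply: (homo_ltn ltn_trans) => i; case: (hP (s i).+1 i.+1).
move=> e e0; near=> j; apply: Pmono (sP j).
apply/ltW; near: j; exact: near_infty_natSinv_lt (PosNum e0).
Unshelve. all: by end_near. Qed.

(** The limit [w] is the pointwise limit along an ultrafilter [U] that is finer
    than the filter of cofinite sets; it exists because bounded closed intervals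
    are compact.  Equicontinuity and the covering form of compactness make the
    convergence along [U] uniform on [K].  Each member of [U] contains arbitrarily
    large indices, so that a subsequence converges uniformly to [w]. *)
Lemma arzela_ascoli (K : set X) (v : nat -> X -> R) (G : R) : compact K ->
  (forall k x, K x -> `|v k x| <= G) ->
  (forall x e, K x -> 0 < e ->
    \forall y \near x, K y -> forall k, `|v k y - v k x| <= e) ->
  exists (s : nat -> nat) (w : X -> R),
    [/\ {homo s : i j / (i < j)%N}, {within K, continuous w}
      & forall e, 0 < e ->
          \forall j \near \oo, forall x, K x -> `|v (s j) x - w x| <= e].
Proof.
move=> cK vG equi.
have [U [UU sU]] := ultraFilterLemma (@eventually_filter).
have [w wP] : exists w : X -> R, forall x, K x -> v k x @[k --> U] --> w x.
  suff E : forall x, exists l : R, K x -> v k x @[k --> U] --> l.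
    by have [w wP] := choice E; exists w.
  move=> x; have [Kx|nKx] := pselect (K x); last by exists 0.
  have := @segment_compact R (- G) G; rewrite compact_ultra /=.
  move=> /(_ _ (ultra_fmap (v ^~ x) UU)) [|l [_ ?]]; last by exists l.
  by apply: nearW => k; rewrite /= in_itv/= -ler_norml vG.
have wU x e : K x -> 0 < e -> \forall k \near U, `|v k x - w x| <= e.
  move=> Kx e0; exact: (cvgr_distC_le _ _ (wP x Kx) e e0).
have wequi x e : K x -> 0 < e -> \forall y \near x, K y -> `|w y - w x| <= e.
  move=> Kx e0; have e30 : 0 < e / 3 by rewrite divr_gt0.
  apply: filterS (equi x _ Kx e30) => y vyx Ky.
  have [k [vy vx]] := filter_ex (filterI (wU y _ Ky e30) (wU x _ Kx e30)).
  have := vyx Ky k; move: vy vx; rewrite !ler_norml.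
  by move=> /andP[? ?] /andP[? ?] /andP[? ?]; apply/andP; lra.
have unif e : 0 < e -> \forall k \near U, forall x, K x -> `|v k x - w x| <= e.
  move=> e0; have e30 : 0 < e / 3 by rewrite divr_gt0.
  have /compact_near_coveringP/near_covering_withinP := cK; apply.
  move=> x Kx; near=> y k => Ky.
  have : `|v k x - w x| <= e / 3 by near: k; exact: wU.
  have vyx : K y -> forall k, `|v k y - v k x| <= e / 3 by near: y; exact: equi.
  have := vyx Ky k.
  have /(_ Ky) : K y -> `|w y - w x| <= e / 3 by near: y; exact: wequi.
  rewrite !ler_norml.
  by move=> /andP[? ?] /andP[? ?] /andP[? ?]; apply/andP; lra.
have [||s s_incr sw] := @extract_subsequence
    (fun e k => forall x, K x -> `|v k x - w x| <= e).
- by move=> e e' k ee' H x /H /le_trans; apply.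
- move=> e N e0.
  have UN : U [set k | (N <= k)%N] by apply: sU; exact: nbhs_infty_ge.
  by have [k [? ?]] := filter_ex (filterI UN (unif e e0)); exists k.
exists s, w; split=> //; apply/subspace_continuousP => x Kx.
apply/cvgrPdist_le => e e0; rewrite near_withinE/=.
by apply: filterS (wequi x e Kx e0) => y + Ky => /(_ Ky); rewrite distrC.
Unshelve. all: by end_near. Qed.

End ArzelaAscoli.

(** * The Dirichlet problem *)

Section UniformConvergence.
Context {R : realType} {X : choiceType}.

Lemma uniform_cvgP (A : set X) (v : nat -> X -> R) (w : X -> R) :
  {uniform A, v @ \oo --> w} <->
  forall e, 0 < e -> \forall k \near \oo, forall x, A x -> `|w x - v k x| < e.
Proof.
split=> [vw e e0|vw].
  apply: (vw [set h | forall x, A x -> `|w x - h x| < e]).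
  apply/uniform_nbhs; exists [set xy | ball xy.1 e xy.2]; split=> //.
  exact: entourage_ball (PosNum e0).
move=> P /uniform_nbhs[E [+ EP]]; rewrite -entourage_ballE => -[e /= e0 eE].
by apply: filterS (vw e e0) => k H; apply: EP => x Ax; apply: eE; exact: H.
Qed.

End UniformConvergence.

Section Domain.
Context {R : realType} {n : nat}.
Implicit Types (u f g : 'rV[R]_n -> R) (Omega K : set 'rV[R]_n).
Implicit Types (x y p : 'rV[R]_n) (D L M e : R).

Lemma compact_closure_bounded Omega : bounded_set Omega -> compact (closure Omega).
Proof.
move=> [M0 [_ M0b]]; pose M := M0 + 1.
have bM : Omega `<=` [set y | `|y - 0| <= M].
  by move=> y Oy /=; rewrite subr0; apply: M0b => //; rewrite ltrDl.
have cM : compact [set y : 'rV[R]_n | `|y - 0| <= M].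
  by apply: (@compact_norm_preimage R n 0 M [set t | t <= M]) => //; exact: closed_le.
apply: (subclosed_compact _ cM); first exact: closed_closure.
rewrite closureE; apply: smallest_sub => //.
exact: compact_closed cM.
Qed.

Lemma compact_diameter K : compact K ->
  exists D, forall x y, K x -> K y -> enorm (x - y) <= D.
Proof.
move=> /compact_bounded[M0 [_ M0b]]; pose M := M0 + 1.
have bM y : K y -> `|y| <= M by move=> Ky; apply: M0b => //; rewrite ltrDl.
exists (n%:R * (M + M)) => x y Kx Ky.
rewrite (le_trans (enorm_le_norm _))// ler_wpM2l//.
by rewrite (le_trans (ler_normB _ _))// lerD// bM.
Qed.

(** A point of the closure where a coordinate is maximal cannot lie in the open set
    itself.  The assumption [0 < n] provides a coordinate. *)
Lemma frontier_nonempty Omega : (0 < n)%N -> open Omega -> compact (closure Omega) ->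
  Omega !=set0 -> frontier Omega !=set0.
Proof.
move=> n0 oO cK [x0 Ox0]; pose i := Ordinal n0.
have cw : {within closure Omega, continuous (fun y : 'rV[R]_n => y ord0 i)}.
  by apply: continuous_subspaceT; exact: coord_continuous.
have [p /set_mem Kp pmax] := compact_EVT_max (ex_intro _ x0 (subset_closure Ox0)) cK cw.
exists p; split=> // /interior_subset Op.
have : \forall t \near (0 : R)^'+, Omega (p + t *: delta_mx ord0 i).
  have pt : p + t *: delta_mx ord0 i @[t --> (0 : R)^'+] --> p + 0 *: delta_mx ord0 i.
    apply: cvgD; first exact: cvg_cst.
    apply: cvgZr_tmp; apply: cvg_at_right_filter; exact: cvg_id.
  rewrite scale0r addr0 in pt; apply: pt.
  exact: open_nbhs_nbhs.
move=> Ot; near (0 : R)^'+ => t.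
have t0 : 0 < t by near: t; exact: nbhs_right_gt.
have /subset_closure/mem_set/pmax : Omega (p + t *: delta_mx ord0 i) by near: t.
by rewrite !mxE !eqxx mulr1 gerDl leNgt t0.
Unshelve. all: by end_near. Qed.

(** Uniform continuity in the form needed for cones.  Near the diagonal the error
    [e] absorbs the oscillation of [g]; for points at
    distance at least [d / 2], a slope [L >= 4 G / d] makes [L |y - x|] at least
    [2 G], where [G] bounds [|g|]. *)
Lemma compact_affine_modulus K g e : compact K -> {within K, continuous g} -> 0 < e ->
  exists2 L, 0 < L & forall x y, K x -> K y -> g y <= g x + e + L * enorm (y - x).
Proof.
move=> cK cg e0.
have [G0 [_ G0b]] := compact_bounded (continuous_compact cg cK).
pose G := `|G0| + 1.
have gG y : K y -> `|g y| <= G.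
  move=> Ky; apply: (G0b G); last by exists y.
  by rewrite /G (le_lt_trans (ler_norm _))// ltrDl.
have : \forall L \near +oo,
    K `<=` (fun y => forall x, K x -> g y <= g x + e + L * `|y - x|).
  have /compact_near_coveringP/near_covering_withinP := cK; apply=> y0 Ky0.
  have : \forall y \near y0, K y -> `|g y0 - g y| < e / 2.
    have /subspace_continuousP/(_ y0 Ky0)/cvgrPdist_lt/(_ (e / 2)) := cg.
    by rewrite near_withinE divr_gt0// => /(_ isT).
  move=> /nbhs_ballP[d /= d0 gd]; rewrite mx_norm_ball in gd.
  have d20 : 0 < d / 2 by rewrite divr_gt0.
  near=> y L => /= Ky x Kx.
  have L0 : 0 <= L by near: L; by apply: nbhs_pinfty_ge; exact: num_real.
  have LG : 4 * G / d <= L by near: L; by apply: nbhs_pinfty_ge; exact: num_real.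
  have yd : `|y0 - y| < d / 2.
    near: y; have := nbhsx_ballx y0 _ d20; by rewrite mx_norm_ball.
  have [xd|xd] := ltP `|y0 - x| d.
    have yd' : `|y0 - y| < d by rewrite (lt_trans yd)// ltr_pdivrMr// ltr_pMr// ltr1n.
    have := gd x xd Kx; have := gd y yd' Ky.
    rewrite !ltr_norml => /andP[? ?] /andP[? ?].
    have : 0 <= L * `|y - x| by rewrite mulr_ge0.
    by lra.
  have yx : d / 2 <= `|y - x|.
    have := ler_normD (y0 - y) (y - x); rewrite addrA subrK; lra.
  have : 4 * G / d * (d / 2) <= L * `|y - x|.
    have G_ge0 : 0 <= G by rewrite addr_ge0.
    by apply: ler_pM => //; [rewrite divr_ge0 ?(ltW d0)// mulr_ge0 | exact: ltW].
  have -> : 4 * G / d * (d / 2) = 2 * G by field; rewrite gt_eqF.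
  have := gG x Kx; have := gG y Ky; rewrite !ler_norml => /andP[? ?] /andP[? ?].
  by lra.
move=> HL; near (+oo : set_system R) => L.
have L0 : 0 < L by near: L; by apply: nbhs_pinfty_gt; exact: num_real.
exists L => // x y Kx Ky.
have /(_ y Ky x Kx) :
    K `<=` (fun y => forall x, K x -> g y <= g x + e + L * `|y - x|).
  by near: L.
by move=> /le_trans; apply; rewrite lerD2l ler_pM2l// norm_le_enorm.
Unshelve. all: by end_near. Qed.

(** Two applications of [cone_comparison], each of which increases the slope by
    [2 (M + 1) D]: to [- u] with the vertex on the frontier, then to [u] with the
    vertex at an arbitrary point [x], for which the first one gives the required
    estimate on the frontier. *)
Lemma dirichlet_solution_modulus Omega f g u D L M e :
  open Omega -> compact (closure Omega) ->
  (forall x y, closure Omega x -> closure Omega y -> enorm (x - y) <= D) ->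
  0 <= M -> (forall x, Omega x -> `|f x| <= M) -> 0 < L -> 0 <= e ->
  (forall x y, frontier Omega x -> frontier Omega y ->
    g y <= g x + e + L * enorm (y - x)) ->
  dirichlet_solution Omega f g u ->
  forall x y, closure Omega x -> closure Omega y ->
    u y <= u x + e + (L + 4 * (M + 1) * D) * enorm (y - x).
Proof.
move=> oO cK KD M0 fM L0 e0 gL [cu [subu /supersolution_opp subNu] ug] x y Kx Ky.
have D0 : 0 <= D by apply: le_trans (KD x x Kx Kx); exact: enorm_ge0.
have C0 : 0 <= 2 * (M + 1) * D by rewrite !mulr_ge0// addr_ge0.
have cNu : {within closure Omega, continuous (fun y => - u y)}.
  by move=> z; apply: cvgN; exact: cu.
have step1 p : frontier Omega p -> forall z, closure Omega z ->
    - u z <= - u p + e + (L + 2 * (M + 1) * D) * enorm (z - p).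
  move=> fp; apply: (cone_comparison oO cK cNu subNu M0) => //.
  - by move=> z Oz; rewrite (le_trans _ (fM z Oz))// -normrN ler_norm.
  - by case: fp.
  - by move=> z Kz; apply: KD => //; case: fp.
  - move=> z fz; rewrite !ug//; have := gL z p fz fp.
    by rewrite -opprB enormN; lra.
have -> : L + 4 * (M + 1) * D = (L + 2 * (M + 1) * D) + 2 * (M + 1) * D by ring.
apply: (cone_comparison oO cK cu subu M0) => //.
- by move=> z Oz; rewrite (le_trans _ (fM z Oz))// ler_norm.
- by move=> z Kz; exact: KD.
- by rewrite ltr_wpDr.
- by move=> z fz; have := step1 z fz x Kx; rewrite -opprB enormN; lra.
Qed.

Lemma sup_norm_bounded Omega (fk : nat -> 'rV[R]_n -> R) :
  (ereal_sup (range (fun k => sup_norm Omega (fk k))) < +oo)%E ->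
  exists2 M, 0 <= M & forall k x, Omega x -> `|fk k x| <= M.
Proof.
set S := ereal_sup _ => Soo; exists `|fine S| => // k x Ox.
have : (`|fk k x|%:E <= S)%E.
  apply: (@le_trans _ _ (sup_norm Omega (fk k))).
    by apply: ereal_sup_ubound; exists x.
  by apply: ereal_sup_ubound; exists k.
case: (S) Soo => [r _||]; rewrite ?ltxx ?leeNy_eq//=.
by rewrite lee_fin => /le_trans; apply; exact: ler_norm.
Qed.

Lemma near_subseq (s : nat -> nat) (P : nat -> Prop) : {homo s : i j / (i < j)%N} ->
  (\forall k \near \oo, P k) -> \forall j \near \oo, P (s j).
Proof.
move=> sh [N _ NP]; exists N => // j /= Nj; apply: NP => /=.
apply: (leq_trans Nj); elim: j {Nj} => // j /leq_ltn_trans; apply; exact: sh.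
Qed.

(** Local uniform convergence together with the continuity of the limit gives
    continuous convergence, which is what is needed at the moving contact points
    of [subsolution_limit]. *)
Lemma locally_uniform_cvg_near Omega (fk : nat -> 'rV[R]_n -> R) f x e :
  {within Omega, continuous f} -> locally_uniform_cvg Omega fk f ->
  Omega x -> 0 < e ->
  \forall y \near x & k \near \oo, Omega y -> `|fk k y - f x| < e.
Proof.
move=> cf fkf Ox e0; have e20 : 0 < e / 2 by rewrite divr_gt0.
have [V Vx /uniform_cvgP/(_ _ e20) Vf] := fkf x Ox.
have fx : \forall y \near x, Omega y -> `|f x - f y| < e / 2.
  have /subspace_continuousP/(_ x Ox)/cvgrPdist_lt/(_ _ e20) := cf.
  by rewrite near_withinE.
near=> y k => Oy.
have /(_ Oy) : Omega y -> `|f x - f y| < e / 2 by near: y.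
have /(_ y) : forall y, (V `&` Omega) y -> `|f y - fk k y| < e / 2 by near: k.
have Vy : V y by near: y.
move=> /(_ (conj Vy Oy)); rewrite !ltr_norml.
by move=> /andP[? ?] /andP[? ?]; apply/andP; lra.
Unshelve. all: by end_near. Qed.

Lemma dirichlet_solution_limit Omega f g u (fk uk : nat -> 'rV[R]_n -> R) :
  open Omega -> {within closure Omega, continuous u} ->
  (forall k, dirichlet_solution Omega (fk k) g (uk k)) ->
  (forall x e, Omega x -> 0 < e ->
    \forall y \near x & k \near \oo, Omega y -> `|fk k y - f x| < e) ->
  (forall e, 0 < e ->
    \forall k \near \oo, forall x, closure Omega x -> `|uk k x - u x| < e) ->
  dirichlet_solution Omega f g u.
Proof.
move=> oO cu sol fkf uku.
have OK : Omega `<=` closure Omega by exact: subset_closure.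
have ukuO e : 0 < e -> \forall k \near \oo, forall x, Omega x -> `|uk k x - u x| < e.
  by move=> /uku; apply: filterS => k + x Ox; apply; exact: OK.
split=> //; last first.
  move=> x fx; apply/eqP; rewrite -subr_eq0 -normr_le0; apply/ler_addgt0Pr => e e0.
  have [k /(_ x)] := filter_ex (uku e e0).
  have [_ _ ->//] := sol k.
  by rewrite distrC add0r => H; apply/ltW/H; case: fx.
split.
  apply: (subsolution_limit (fk := fk) (uk := uk)) => //.
  - by move=> k; have [c _ _] := sol k; exact: continuous_subspaceW c.
  - exact: continuous_subspaceW cu.
  - by move=> k; have [_ [? _] _] := sol k.
  - move=> x e Ox e0; have := fkf x e Ox e0; apply: filterS => -[y k] /= H Oy.
    by have := H Oy; rewrite ltr_norml => /andP[_]; lra.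
apply/supersolution_opp.
apply: (subsolution_limit (fk := fun k x => - fk k x) (uk := fun k x => - uk k x)) => //.
- move=> k; have [c _ _] := sol k; have {}c := continuous_subspaceW OK c.
  by move=> x; apply: cvgN; exact: c.
- by have c := continuous_subspaceW OK cu; move=> x; apply: cvgN; exact: c.
- by move=> k; have [_ [_ ?] _] := sol k; apply/supersolution_opp.
- move=> x e Ox e0; have := fkf x e Ox e0; apply: filterS => -[y k] /= H Oy.
  by have := H Oy; rewrite ltr_norml => /andP[+ _]; lra.
- move=> e /ukuO; apply: filterS => k H x Ox.
  by rewrite -opprD normrN; exact: H.
Qed.

End Domain.

Unset Implicit Arguments.
Set Strict Implicit.

Theorem theorem2p13 (R : realType) (n : nat) (n_gt0 : (0 < n)%N)
    (Omega : set 'rV[R]_n)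
    (Omega_bounded : bounded_set Omega)
    (Omega_connected : connected Omega)
    (Omega_open : open Omega)
    (Omega_diam : (path_diam Omega < +oo)%E)
    (g : 'rV[R]_n -> R)
    (g_cont : {within frontier Omega, continuous g})
    (f : 'rV[R]_n -> R)
    (f_cont : {within Omega, continuous f})
    (f_bounded : (sup_norm Omega f < +oo)%E)
    (fk : nat -> 'rV[R]_n -> R)
    (fk_cont : forall k, {within Omega, continuous (fk k)})
    (fk_bounded : forall k, (sup_norm Omega (fk k) < +oo)%E)
    (fk_sup : (ereal_sup (range (fun k => sup_norm Omega (fk k))) < +oo)%E)
    (fk_cvg : locally_uniform_cvg Omega fk f)
    (uk : nat -> 'rV[R]_n -> R)
    (uk_sol : forall k, dirichlet_solution Omega (fk k) g (uk k)) :
  exists (s : nat -> nat) (u : 'rV[R]_n -> R),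
    [/\ {homo s : i j / (i < j)%N},
        dirichlet_solution Omega f g u
      & {uniform closure Omega, (fun j => uk (s j)) @ \oo --> u}].
Proof.
have cK := compact_closure_bounded Omega_bounded.
have [D KD] := compact_diameter cK.
have [M M0 fM] := sup_norm_bounded fk_sup.
have cF : compact (frontier Omega).
  apply: (subclosed_compact _ cK); last by move=> x [].
  by apply: closedI; [exact: closed_closure | apply: open_closedC; exact: open_interior].
have equi e : 0 < e -> exists2 L, 0 <= L & forall k x y, closure Omega x ->
    closure Omega y -> `|uk k y - uk k x| <= e + L * enorm (y - x).
  move=> e0; have [L L0 gL] := compact_affine_modulus cF g_cont e0.
  have mod k := dirichlet_solution_modulus Omega_open cK KD M0 (fM k) L0
    (ltW e0) gL (uk_sol k).
  exists `|L + 4 * (M + 1) * D| => // k x y Kx Ky.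
  have C := ler_wpM2r (enorm_ge0 (y - x)) (ler_norm (L + 4 * (M + 1) * D)).
  have := mod k x y Kx Ky; have := mod k y x Ky Kx; rewrite -opprB enormN => ? ?.
  by rewrite ler_norml; apply/andP; split; lra.
have [G uG] : exists G, forall k x, closure Omega x -> `|uk k x| <= G.
  have [[x0 Ox0]|O0] := pselect (Omega !=set0); last first.
    exists 0 => k x; have -> : Omega = set0.
      by rewrite -subset0 => y Oy; apply: O0; exists y.
    by rewrite closure0.
  have [p fp] := frontier_nonempty n_gt0 Omega_open cK (ex_intro _ x0 Ox0).
  have [L L0 uL] := equi 1 ltr01.
  exists (`|g p| + (1 + L * D)) => k x Kx.
  have Kp : closure Omega p by case: fp.
  have [_ _ ug] := uk_sol k.
  rewrite -(subrK (uk k p) (uk k x)) addrC (le_trans (ler_normD _ _))// ug// lerD2l.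
  rewrite -(ug p fp) (le_trans (uL k p x Kp Kx))// lerD2l.
  by apply: ler_wpM2l => //; exact: KD.
have [|s [u [s_incr cu su]]] := @arzela_ascoli R _ (closure Omega) uk G cK uG.
  move=> x e Kx e0; have e20 : 0 < e / 2 by rewrite divr_gt0.
  have [L L0 uL] := equi _ e20.
  have Lx : L * enorm (y - x) @[y --> x] --> L * enorm (x - x).
    have ex := cvg_comp _ _ (@subr_right_cvg _ _ x x) (@enorm_continuous _ _ _).
    exact: (cvgM (cvg_cst L) ex).
  have : \forall y \near x, L * enorm (y - x) <= e / 2.
    by apply: (cvgr_le _ Lx); rewrite subrr enorm0 mulr0.
  apply: filterS => y ye Ky k; apply: (le_trans (uL k x y Kx Ky)); lra.
have su' e : 0 < e ->
    \forall j \near \oo, forall x, closure Omega x -> `|uk (s j) x - u x| < e.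
  move=> e0; have e20 : 0 < e / 2 by rewrite divr_gt0.
  apply: filterS (su _ e20) => j H x Kx; apply: (le_lt_trans (H x Kx)).
  by rewrite ltr_pdivrMr// ltr_pMr// ltr1n.
exists s, u; split=> //.
  apply: (dirichlet_solution_limit (fk := fk \o s) (uk := uk \o s)) => //.
    by move=> k; exact: uk_sol.
  move=> x e Ox e0.
  have [[P Q] /= [Px Qoo] PQ] := locally_uniform_cvg_near f_cont fk_cvg Ox e0.
  exists (P, [set j | Q (s j)]) => /=; first by split=> //; exact: near_subseq.
  by move=> [y j] /= [Py Qj]; exact: (PQ (y, s j)).
apply/uniform_cvgP => e /su'; apply: filterS => j H x Kx.
by rewrite distrC; exact: H.
Qed.
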